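(* Let $n\ge2$, let $K(g,h)=K(h^{-1}\cdot g)$ ($g\ne h$) be the Cauchy--Szegő kernel on the quaternionic Heisenberg group $\mathscr H^{n-1}$, and let $Q=4n+2$. There exist a (large) positive constant $r_0$ and a positive constant $C$ such that for every $g\in\mathscr H^{n-1}$ there exists a set $S_g\subset\mathscr H^{n-1}$ (a ''twisted truncated sector'') such that $$\inf_{g'\in S_g}\rho(g,g')=r_0,$$ and such that for every $g_1\in B(g,1)$ and every $g_2\in S_g$, $$|K(g_1,g_2)|\ge\frac{C}{\rho(g_1,g_2)^Q}.$$ Moreover, $S_g$ is regular in the sense that $|S_g|=\infty$ and that for every $R_2>R_1>2r_0$, $$\big|\big(B(g,R_2)\setminus B(g,R_1)\big)\cap S_g\big|\approx\big|B(g,R_2)\setminus B(g,R_1)\big|,$$ with implicit constants independent of $g$ and of $R_1,R_2$.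
   Context: $\mathbb H$ denotes the quaternions. The quaternionic Heisenberg group $\mathscr H^{n-1}$ is $\operatorname{Im}\mathbb H\times\mathbb H^{n-1}\cong\mathbb R^3\times\mathbb R^{4(n-1)}$ with product $(t,y)\cdot(t',y')=(t+t'+2\operatorname{Im}\langle y,y'\rangle,\,y+y')$, $\langle y,y'\rangle=\sum_{l=1}^{n-1}\overline{y}_l y'_l$, neutral element $\mathbf 0$ and inverse $(t,y)^{-1}=(-t,-y)$. Homogeneous norm: $\|(t,y)\|=(|y|^4+|t|^2)^{1/4}$; quasi-distance $\rho(h,g)=\|g^{-1}\cdot h\|$; balls $B(g,r)=\{h:\rho(h,g)<r\}$. $|E|$ denotes the Haar (Lebesgue) measure of a measurable set $E$. $A\approx B$ means $C_1B\le A\le C_2B$ for positive constants $C_1,C_2$. The Cauchy--Szegő kernel on $\mathscr H^{n-1}$ is the $\mathbb H$-valued function $$K(g)=s(|y|^2+t),\quad g=(t,y)\neq\mathbf 0,\qquad s(\sigma)=c_{n-1}\frac{\partial^{2(n-1)}}{\partial x_1^{2(n-1)}}\frac{\overline\sigma}{|\sigma|^4},\quad\sigma=x_1+x_2\mathbf i+x_3\mathbf j+x_4\mathbf k\ne0,$$ where $c_{n-1}$ is a nonzero real constant depending only on $n$ (the normalizing constant of the Cauchy--Szegő kernel of the quaternionic Siegel upper half-space). ''Twisted truncated sector'' is only a name for the measurable set $S_g$ with the stated properties. *)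

(* Defs.v *)
From HB Require Import structures.
From mathcomp Require Import all_boot all_order all_algebra.
From mathcomp Require Import all_classical all_reals all_analysis.
Set Implicit Arguments.
Unset Strict Implicit.
Unset Printing Implicit Defensive.
Import Order.TTheory GRing.Theory Num.Theory.
Import numFieldNormedType.Exports.
Local Open Scope classical_set_scope.
Local Open Scope ring_scope.

(* The imaginary quaternion [x2 i + x3 j + x4 k] is [(x2, x3, x4)], and the
   quaternion [x1 + x2 i + x3 j + x4 k] is [(x1, (x2, x3, x4))].  Addition,
   opposite, scaling by reals, topology and Borel sets are those of the product
   types.  The norm [`| _ |] of the product types is the sup norm and is not
   used: the Euclidean norms are [imqnorm] and [qnorm]. *)
Definition imquat (R : realType) : Type := (R * R * R)%type.
Definition quat (R : realType) : Type := (R * (R * R * R))%type.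

(* The quaternionic Heisenberg group Im H x H^m, of real dimension 4 m + 3. *)
Definition heis (R : realType) (m : nat) : Type :=
  (imquat R * m.-tuple (quat R))%type.

HB.instance Definition _ (R : realType) :=
  NormedModule.copy (imquat R) (R * R * R)%type.
HB.instance Definition _ (R : realType) :=
  NormedModule.copy (quat R) (R * (R * R * R))%type.
HB.instance Definition _ (R : realType) := Measurable.copy (imquat R)
  (measurableTypeR R * measurableTypeR R * measurableTypeR R)%type.
HB.instance Definition _ (R : realType) :=
  Measurable.copy (quat R) (measurableTypeR R * imquat R)%type.
HB.instance Definition _ (R : realType) (m : nat) :=
  Measurable.copy (heis R m) (imquat R * m.-tuple (quat R))%type.

Section Quaternions.
Context {R : realType}.
Implicit Types p q : quat R.

Definition qre p : R := p.1.
Definition qim p : imquat R := p.2.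
Definition qi p : R := p.2.1.1.
Definition qj p : R := p.2.1.2.
Definition qk p : R := p.2.2.

Definition qconj p : quat R := (qre p, - qim p).

Definition qmul p q : quat R :=
  (qre p * qre q - qi p * qi q - qj p * qj q - qk p * qk q,
   (qre p * qi q + qi p * qre q + qj p * qk q - qk p * qj q,
    qre p * qj q - qi p * qk q + qj p * qre q + qk p * qi q,
    qre p * qk q + qi p * qj q - qj p * qi q + qk p * qre q)).

Definition qnorm p : R :=
  Num.sqrt (qre p ^+ 2 + qi p ^+ 2 + qj p ^+ 2 + qk p ^+ 2).

Definition imqnorm (t : imquat R) : R :=
  Num.sqrt (t.1.1 ^+ 2 + t.1.2 ^+ 2 + t.2 ^+ 2).

End Quaternions.

Section HeisenbergGroup.
Context {R : realType} {m : nat}.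
Implicit Types (y : m.-tuple (quat R)) (g h : heis R m).

Definition hform y y' : quat R :=
  \sum_(l < m) qmul (qconj (tnth y l)) (tnth y' l).

Definition vnorm y : R := Num.sqrt (\sum_(l < m) qnorm (tnth y l) ^+ 2).

Definition hmul g h : heis R m :=
  (g.1 + h.1 + 2 *: qim (hform g.2 h.2),
   [tuple tnth g.2 l + tnth h.2 l | l < m]).

Definition hinv g : heis R m := (- g.1, [tuple - tnth g.2 l | l < m]).

Definition hnorm g : R := (vnorm g.2 ^+ 4 + imqnorm g.1 ^+ 2) `^ (4^-1).

Definition hdist h g : R := hnorm (hmul (hinv g) h).

Definition hball g (r : R) : set (heis R m) := [set h | hdist h g < r].

End HeisenbergGroup.

(* [m1 \x m2] under a name of its own, so that it carries a canonical
   sigma-finite structure when m1 and m2 are sigma-finite. *)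
Section ProductMeasure.
Context d1 d2 (T1 : measurableType d1) (T2 : measurableType d2) (R : realType).
Variable m1 : {sigma_finite_measure set T1 -> \bar R}.
Variable m2 : {sigma_finite_measure set T2 -> \bar R}.

Definition prod_measure : set (T1 * T2)%type -> \bar R := (m1 \x m2)%E.

HB.instance Definition _ := Measure.on prod_measure.

Let prod_measure_sigma_finite : sigma_finite setT prod_measure.
Proof.
have /sigma_finiteP[F [TF ndF Foo]] := sigma_finiteT m1.
have /sigma_finiteP[G [TG ndG Goo]] := sigma_finiteT m2.
exists (fun k => F k `*` G k).
  rewrite -setXTT TF TG predeqE => -[x y]; split.
    move=> [/= [i _ Fix] [j _ Gjy]]; exists (maxn i j) => //; split.
    - by move: x Fix; exact/subsetPset/ndF/leq_maxl.
    - by move: y Gjy; exact/subsetPset/ndG/leq_maxr.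
  by move=> [i _ []/= ? ?]; split; exists i.
move=> k; have [? ?] := Foo k; have [? ?] := Goo k.
split; first exact: measurableX.
by rewrite /prod_measure product_measure1E// lte_mul_pinfty// ge0_fin_numE.
Qed.

HB.instance Definition _ := Measure_isSigmaFinite.Build _ _ _ prod_measure
  prod_measure_sigma_finite.

End ProductMeasure.

(* The product measure on T^m = T x (T x ... ), carried to m-tuples along
   (x, u) |-> x :: u.  T^0 is a point, of mass 1. *)
Section TupleMeasure.
Context d (T : measurableType d) (R : realType).
Variable mu : {sigma_finite_measure set T -> \bar R}.

Definition tuple_cons (m : nat) (xu : T * m.-tuple T) : m.+1.-tuple T :=
  [tuple of xu.1 :: xu.2].

Definition tuple_uncons (m : nat) (u : m.+1.-tuple T) : T * m.-tuple T :=
  (thead u, [tuple of behead u]).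

Lemma tuple_consK (m : nat) : cancel (@tuple_cons m) (@tuple_uncons m).
Proof. by move=> [x u]; congr pair; exact: val_inj. Qed.

Lemma measurable_tuple_cons (m : nat) : measurable_fun setT (@tuple_cons m).
Proof. exact: measurable_cons. Qed.

Lemma measurable_tuple_uncons (m : nat) :
  measurable_fun setT (@tuple_uncons m).
Proof.
by apply: measurable_fun_pair; [exact: measurable_tnth|
                                exact: measurable_behead].
Qed.

Section Cons.
Context {m : nat}.
Variable nu : {sigma_finite_measure set (m.-tuple T) -> \bar R}.

Definition cons_measure : set (m.+1.-tuple T) -> \bar R :=
  pushforward (prod_measure mu nu) (@tuple_cons m).

Let cons0 : cons_measure set0 = 0%E.
Proof. by rewrite /cons_measure /pushforward preimage_set0 measure0. Qed.

Let cons_ge0 A : (0 <= cons_measure A)%E.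
Proof. by rewrite /cons_measure /pushforward measure_ge0. Qed.

Let cons_sigma_additive : semi_sigma_additive cons_measure.
Proof.
have mpre A : measurable A -> measurable (@tuple_cons m @^-1` A).
  by move=> mA; rewrite -[X in measurable X]setTI; exact: measurable_tuple_cons.
move=> F mF tF mUF; rewrite /cons_measure /pushforward preimage_bigcup.
apply: measure_semi_sigma_additive.
- by move=> i; exact: mpre.
- apply/trivIsetP => i j _ _ ij.
  rewrite -preimage_setI.
  by move/trivIsetP : tF => /(_ _ _ _ _ ij) ->//; rewrite preimage_set0.
- by rewrite -preimage_bigcup; exact: mpre.
Qed.

HB.instance Definition _ := isMeasure.Build _ _ _ cons_measure
  cons0 cons_ge0 cons_sigma_additive.

Let cons_sigma_finite : sigma_finite setT cons_measure.
Proof.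
have [F TF mF] := sigma_finiteT (prod_measure mu nu).
exists (fun k => @tuple_uncons m @^-1` F k).
  by rewrite -preimage_bigcup -TF preimage_setT.
move=> k; have [mFk Fk] := mF k; split.
  by rewrite -[X in measurable X]setTI; exact: measurable_tuple_uncons.
rewrite /cons_measure /pushforward -comp_preimage.
by rewrite (_ : _ \o _ = id)//; apply/funext => xu /=; rewrite tuple_consK.
Qed.

HB.instance Definition _ := Measure_isSigmaFinite.Build _ _ _ cons_measure
  cons_sigma_finite.

End Cons.

Fixpoint tuple_measure (m : nat) :
    {sigma_finite_measure set (m.-tuple T) -> \bar R} :=
  match m with
  | 0 => \d_ ([tuple] : 0.-tuple T)
  | m'.+1 => cons_measure (tuple_measure m')
  end.

End TupleMeasure.

Section LebesgueMeasure.
Context {R : realType}.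
Local Notation lambda := (@lebesgue_measure R).

Definition imquat_leb : {sigma_finite_measure set (imquat R) -> \bar R} :=
  (prod_measure (prod_measure lambda lambda) lambda
    : {sigma_finite_measure set _ -> \bar R}).

Definition quat_leb : {sigma_finite_measure set (quat R) -> \bar R} :=
  (prod_measure lambda imquat_leb
    : {sigma_finite_measure set _ -> \bar R}).

Definition heis_leb {m : nat} :
    {sigma_finite_measure set (heis R m) -> \bar R} :=
  (prod_measure imquat_leb (tuple_measure quat_leb m)
    : {sigma_finite_measure set _ -> \bar R}).

End LebesgueMeasure.

Section CauchySzego.
Context {R : realType}.

Definition qker (p : quat R) : quat R := (qnorm p ^+ 4)^-1 *: qconj p.

Definition dre (k : nat) (f : quat R -> quat R) (p : quat R) : quat R :=
  derive1n k (fun x1 : R => f (x1, qim p)) (qre p).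

(* [c] is the normalizing constant and [m] is n - 1. *)
Definition cs_s (c : R) (m : nat) (p : quat R) : quat R :=
  c *: dre (2 * m)%N qker p.

(* The value at the neutral element is junk. *)
Definition cs_kernel (c : R) (m : nat) (g : heis R m) : quat R :=
  cs_s c m (vnorm g.2 ^+ 2, g.1).

Definition cs_kernel2 (c : R) (m : nat) (g h : heis R m) : quat R :=
  cs_kernel c (hmul (hinv h) g).

End CauchySzego.

(* Main.v *)
Require Import Defs.
From HB Require Import structures.
From mathcomp Require Import all_boot all_order all_algebra.
From mathcomp Require Import all_classical all_reals all_analysis.
From mathcomp Require Import measurable_realfun ring lra.
Set Implicit Arguments.
Unset Strict Implicit.
Unset Printing Implicit Defensive.
Import Order.TTheory GRing.Theory Num.Theory.
Import numFieldNormedType.Exports.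
Local Open Scope classical_set_scope.
Local Open Scope ring_scope.

(** Near the plane t = 0 the Cauchy-Szego kernel behaves like c |y|^(-Q), up to
    a nonzero factor: writing u = |t|^2 / |y|^4, the real part of the k-th
    derivative of conj(s) / |s|^4 at s = |y|^2 + t is
      |y|^(-2 (k + 3)) p_k(u) (1 + u)^(-(k + 2))
    for a polynomial p_k with p_k(0) <> 0.  Hence |K(h)| >= C / ||h||^Q on some
    cone |t|^2 <= d |y|^4.  The sector S_g is the left translate by g of a
    narrower cone |t|^2 <= e^2 |y|^4 truncated at ||.|| >= r0.  If w is in that
    truncated cone and u in the unit ball, then w^-1 u still lies in the wide
    cone, by Young's inequality, as soon as r0 is large; this is applied to
    w = g^-1 g2 and u = g^-1 g1, for which g2^-1 g1 = w^-1 u.  Finally left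
    translations preserve the measure and the dilations (t, y) -> (r^2 t, r y)
    multiply it by r^Q, so that a dilation-invariant cone meets every annulus
    in a fixed proportion of its measure. *)

(** * Measurable maps multiplying a measure by a constant *)

Section ScalingMaps.
Context {R : realType}.

(** The constant is attached to preimages: for an affine map of positive ratio it is the reciprocal
    of the Jacobian determinant. *)
Definition scales_measure {d} {T : measurableType d}
    (mu : set T -> \bar R) (f : T -> T) (a : R) : Prop :=
  [/\ 0 < a, measurable_fun setT f &
      forall A, measurable A -> mu (f @^-1` A) = (a%:E * mu A)%E].

Lemma measurable_preimage d d' (T : measurableType d) (U : measurableType d')
    (f : T -> U) (A : set U) :
  measurable_fun setT f -> measurable A -> measurable (f @^-1` A).
Proof. by move=> mf mA; rewrite -[X in measurable X]setTI; exact: mf. Qed.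

(** Exchanging the order of integration puts slices at a fixed second coordinate inside the
    integral; these are the slices on which [scales_skew] acts by [f y]. *)
Lemma product_measureE d1 d2 (T1 : measurableType d1) (T2 : measurableType d2)
    (m1 : {sigma_finite_measure set T1 -> \bar R})
    (m2 : {sigma_finite_measure set T2 -> \bar R}) (X : set (T1 * T2)) :
  measurable X -> prod_measure m1 m2 X = (m1 \x^ m2)%E X.
Proof.
apply: (@product_measure_unique _ _ _ _ _ m1 m2 (m1 \x^ m2)%E).
by move=> A B mA mB; exact: product_measure2E.
Qed.

(** Tonelli for triangular maps. The preimage of A x B has slice [f y @^-1] A over y in [g @^-1] B
    and an empty slice elsewhere, so rectangles scale by [a * b]. Hence (ab)^-1 times the
    pushforward agrees with the product measure on rectangles, and by uniqueness everywhere. *)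
Lemma scales_skew d1 d2 (T1 : measurableType d1) (T2 : measurableType d2)
    (m1 : {sigma_finite_measure set T1 -> \bar R})
    (m2 : {sigma_finite_measure set T2 -> \bar R})
    (f : T2 -> T1 -> T1) (g : T2 -> T2) (a b : R) :
  measurable_fun setT (fun z : T1 * T2 => f z.2 z.1) ->
  (forall y, scales_measure m1 (f y) a) -> scales_measure m2 g b ->
  scales_measure (prod_measure m1 m2) (fun z => (f z.2 z.1, g z.2)) (a * b).
Proof.
move=> mf fa [b0 mg gb].
have a0 : 0 < a by have [] := fa point.
have mF : measurable_fun setT (fun z : T1 * T2 => (f z.2 z.1, g z.2)).
  apply: measurable_fun_pair => //=.
  exact: (measurableT_comp mg).
split; [exact: mulr_gt0|exact: mF|move=> C mC].
have ab0 : 0 <= (a * b)^-1 by rewrite invr_ge0 ltW// mulr_gt0.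
pose F z := (f z.2 z.1, g z.2).
(* The measure structure of a pushforward is parametrized by the proof that
   the map is measurable, so [m'_] is a function of that proof. *)
pose m'_ : {measure set (T1 * T2) -> \bar R} :=
  mscale (NngNum ab0) (pushforward (prod_measure m1 m2) F).
pose m' := m'_ mF.
have m'E A B : measurable A -> measurable B -> m' (A `*` B) = (m1 A * m2 B)%E.
  move=> mA mB.
  rewrite /m' /m'_ /= /mscale /= /pushforward product_measureE; last first.
    apply: measurable_preimage => //; exact: measurableX.
  rewrite /product_measure2.
  under eq_integral => y _.
    rewrite (_ : _ y = (a%:E * m1 A * (\1_(g @^-1` B) y)%:E)%E).
      over.
    rewrite /= indicE; have [gB|gB] := boolP (y \in _).
      rewrite mule1; have [_ _ <-//] := fa y; congr (m1 _).
      apply/seteqP; split => x; rewrite /ysection /= inE => //=.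
        by case.
      by move=> ?; split => //; rewrite inE in gB.
    rewrite mule0 (_ : ysection _ _ = set0) ?measure0//.
    apply/seteqP; split => x; rewrite /ysection /= inE => //= -[_ h].
    by move: gB; rewrite notin_setE.
  rewrite ge0_integralZl//=; last 2 first.
  - apply/measurable_EFinP; apply: measurable_indic.
    exact: measurable_preimage.
  - by rewrite mule_ge0// lee_fin ltW.
  rewrite integral_indic ?setIT//; last exact: measurable_preimage.
  rewrite [X in (_ * (_ * X))%E](_ : _ = b%:E * m2 B)%E; last exact: gb.
  rewrite muleACA -EFinM.
  by rewrite !muleA -EFinM mulVf ?mul1e// gt_eqF// mulr_gt0.
rewrite [X in (_ = _ * X)%E](product_measure_unique m'E)//.
rewrite /m' /m'_ /= /mscale /=.
by rewrite muleA -EFinM mulfV ?mul1e// gt_eqF// mulr_gt0.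
Qed.

(** Lebesgue measure is determined by its values on half-open intervals, and r times the pushforward
    has the same values there. *)
Lemma lebesgue_affine (r s : R) : 0 < r ->
  scales_measure (@lebesgue_measure R) (fun x => r * x + s) r^-1.
Proof.
move=> r0.
have mF : measurable_fun setT (fun x : measurableTypeR R => r * x + s).
  by apply: measurable_funD => //; exact: measurable_funM.
split; [by rewrite invr_gt0|exact: mF|move=> A mA].
pose F (x : measurableTypeR R) : measurableTypeR R := r * x + s.
pose m'_ : {measure set (measurableTypeR R) -> \bar R} :=
  mscale (NngNum (ltW r0)) (pushforward (@lebesgue_measure R) F).
pose m' := m'_ mF.
rewrite [X in (_ = _ * X)%E](@lebesgue_measure_unique _ m')//.
  rewrite /m' /m'_ /= /mscale /=.
  by rewrite muleA -EFinM mulVf ?mul1e// gt_eqF.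
move=> _ [[a b] /= _ <-].
rewrite /m' /m'_ /= /mscale /= /pushforward.
rewrite (_ : F @^-1` _ = `](a - s) / r, (b - s) / r]%classic); last first.
  apply/seteqP; split => x /=; rewrite !in_itv /= /F;
    by rewrite ler_pdivlMr// ltr_pdivrMr//; lra.
rewrite !lebesgue_measure_itv /= !lte_fin ltr_pM2r ?invr_gt0// ltrD2r.
case: ifPn => ab; last by rewrite mule0.
rewrite -!EFinB -EFinM; congr EFin; field; exact: lt0r_neq0.
Qed.

End ScalingMaps.

(** * Affine maps of tuples, quaternions and the Heisenberg group *)

Section AffineMaps.
Context {R : realType}.
(** Induction on the length: splitting off the head turns the map into a product map, a case of
    [scales_skew] whose first component does not depend on the second. *)
Lemma scales_tuple d (T : measurableType d)
    (mu : {sigma_finite_measure set T -> \bar R}) (a : R) (m : nat)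
    (f : 'I_m -> T -> T) : 0 < a -> (forall l, scales_measure mu (f l) a) ->
  scales_measure (tuple_measure mu m)
    (fun u => [tuple f l (tnth u l) | l < m]) (a ^+ m).
Proof.
move=> a0 fa.
have mF (k : nat) (h : 'I_k -> T -> T) :
    (forall l, scales_measure mu (h l) a) ->
    measurable_fun setT (fun u : k.-tuple T => [tuple h l (tnth u l) | l < k]).
  move=> ha; apply/measurable_fun_tnthP => i /=.
  rewrite (_ : _ \o _ = h i \o (fun u => tnth u i)).
    have [_ mh _] := ha i.
    by apply: measurableT_comp => //; exact: measurable_tnth.
  by apply/funext => u /=; rewrite tnth_mktuple.
elim: m f fa => [|m ih] f fa.
  split; [by rewrite expr0|exact: mF|move=> A mA].
  rewrite expr0 mul1e; congr (_ _); apply/funext => u /=.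
  by rewrite (tuple0 [tuple _ | _ < _]) (tuple0 u).
have ih' := ih (fun l => f (lift ord0 l)) (fun l => fa (lift ord0 l)).
split; [exact: exprn_gt0|exact: mF|move=> A mA].
have [_ mf0 _] := fa ord0.
have mf0' : measurable_fun setT (fun z : T * m.-tuple T => f ord0 z.1).
  by apply: measurableT_comp mf0 _; exact: measurable_fst.
have [_ _ skew] := scales_skew (f := fun _ => f ord0) mf0'
  (fun _ => fa ord0) ih'.
pose nu := prod_measure mu (tuple_measure mu m).
rewrite exprS [RHS](_ : _ =
  ((a * a ^+ m)%:E * nu (@tuple_cons _ T m @^-1` A))%E)//.
rewrite -skew; last first.
  by rewrite -[X in measurable X]setTI; exact: measurable_tuple_cons.
rewrite [LHS](_ : _ = nu (@tuple_cons _ T m @^-1`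
  ((fun u => [tuple f l (tnth u l) | l < m.+1]) @^-1` A)))//.
congr (nu _); apply/funext => -[x u] /=.
congr (A _); apply: eq_from_tnth => i; rewrite tnth_mktuple.
case: (unliftP ord0 i) => [j ->|->]; last by rewrite !(tnth_nth x).
rewrite !(tnth_nth x) /= (nth_map j) ?size_enum_ord ?add0n//=.
by rewrite nth_ord_enum (tnth_nth x).
Qed.

Lemma scales_prod d1 d2 (T1 : measurableType d1) (T2 : measurableType d2)
    (m1 : {sigma_finite_measure set T1 -> \bar R})
    (m2 : {sigma_finite_measure set T2 -> \bar R})
    (f : T1 -> T1) (g : T2 -> T2) (a b : R) :
  scales_measure m1 f a -> scales_measure m2 g b ->
  scales_measure (prod_measure m1 m2) (fun z => (f z.1, g z.2)) (a * b).
Proof.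
move=> fa; apply: (scales_skew (f := fun _ => f)) => //.
by have [_ mf _] := fa; apply: measurableT_comp mf _; exact: measurable_fst.
Qed.

Lemma imquat_affine (r : R) (s : imquat R) : 0 < r ->
  scales_measure (@imquat_leb R) (fun t : imquat R => r *: t + s) (r ^- 3).
Proof.
move=> r0.
have := scales_prod (scales_prod (lebesgue_affine s.1.1 r0)
  (lebesgue_affine s.1.2 r0)) (lebesgue_affine s.2 r0).
rewrite (_ : _ * _ * _ = r ^- 3)//.
by rewrite -exprVn !exprS expr0 mulr1 mulrA.
Qed.

Lemma quat_affine (r : R) (s : quat R) : 0 < r ->
  scales_measure (@quat_leb R) (fun q : quat R => r *: q + s) (r ^- 4).
Proof.
move=> r0.
have := scales_prod (lebesgue_affine s.1 r0) (imquat_affine s.2 r0).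
by rewrite (_ : _ * _ = r ^- 4)// -!exprVn exprS.
Qed.

(** Naming the three imaginary directions lets identities and bounds in Im H be treated one real
    coordinate at a time. *)
Variant axis := AxisI | AxisJ | AxisK.

Definition imcoord (i : axis) (t : imquat R) : R :=
  match i with AxisI => t.1.1 | AxisJ => t.1.2 | AxisK => t.2 end.

Lemma imcoordD i (t t' : imquat R) :
  imcoord i (t + t') = imcoord i t + imcoord i t'.
Proof. by case: i. Qed.

Lemma imcoordN i (t : imquat R) : imcoord i (- t) = - imcoord i t.
Proof. by case: i. Qed.

Lemma imcoordZ i (a : R) (t : imquat R) : imcoord i (a *: t) = a * imcoord i t.
Proof. by case: i. Qed.

Lemma imcoordP (t t' : imquat R) :
  (forall i, imcoord i t = imcoord i t') -> t = t'.
Proof.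
move: t t' => [[a b] c] [[a' b'] c'] h.
have /= -> := h AxisI; have /= -> := h AxisJ; by have /= -> := h AxisK.
Qed.

Lemma measurable_imcoord i : measurable_fun setT (imcoord i).
Proof.
case: i.
- apply: (measurableT_comp (f := fst)); exact: measurable_fst.
- exact: (measurableT_comp measurable_snd measurable_fst).
- exact: measurable_snd.
Qed.

Lemma measurable_imquat d (T : measurableType d) (f : T -> imquat R) :
  (forall i, measurable_fun setT (fun x => imcoord i (f x))) ->
  measurable_fun setT f.
Proof.
move=> mf.
rewrite (_ : f = fun x => ((f x).1.1, (f x).1.2, (f x).2)); last first.
  by apply/funext => x; case: (f x) => -[].
apply: measurable_fun_pair (mf AxisK).
exact: measurable_fun_pair (mf AxisI) (mf AxisJ).
Qed.

(** Common form of left translations and dilations: affine in each coordinate of y, and in t affine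
    with a shift depending measurably on y. The two ratios are separate because a dilation has s =
    r^2. *)
Lemma heis_affine (m : nat) (r s : R) (k : m.-tuple (quat R) -> imquat R)
    (v : m.-tuple (quat R)) : 0 < r -> 0 < s ->
  (forall i, measurable_fun setT (fun y => imcoord i (k y))) ->
  scales_measure (@heis_leb R m)
    (fun g => (s *: g.1 + k g.2, [tuple r *: tnth g.2 l + tnth v l | l < m]))
    (s ^- 3 * r ^- (4 * m)).
Proof.
move=> r0 s0 mk.
have mf : measurable_fun setT
    (fun z : imquat R * m.-tuple (quat R) => s *: z.1 + k z.2 : imquat R).
  apply: measurable_imquat => i; under eq_fun do rewrite imcoordD imcoordZ.
  apply: measurable_funD.
    apply: measurable_funM => //.
    exact: (measurableT_comp (measurable_imcoord i) measurable_fst).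
  exact: (measurableT_comp (mk i) measurable_snd).
have ht : scales_measure (tuple_measure (@quat_leb R) m)
    (fun y => [tuple r *: tnth y l + tnth v l | l < m]) ((r ^- 4) ^+ m).
  apply: (@scales_tuple _ (quat R) (@quat_leb R) _ m
    (fun l q => r *: q + tnth v l)).
    by rewrite invr_gt0 exprn_gt0.
  by move=> l; exact: quat_affine.
have := @scales_skew _ _ _ _ _ (@imquat_leb R) (tuple_measure quat_leb m)
  (fun y t => s *: t + k y) _ _ _ mf (fun y => imquat_affine (k y) s0) ht.
by rewrite exprVn -exprM.
Qed.
End AffineMaps.

(** * Boxes of positive finite measure *)

Section FiniteBoxes.
Context {R : realType}.

Definition positive_finite {d} {T : measurableType d} (mu : set T -> \bar R)
    (A : set T) : Prop :=
  [/\ measurable A, (0 < mu A)%E & (mu A < +oo)%E].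

Lemma positive_finite_itv (a b : R) : a < b ->
  positive_finite (@lebesgue_measure R) `[a, b]%classic.
Proof.
move=> ab; rewrite /positive_finite lebesgue_measure_itv /= lte_fin ab.
by split => //; rewrite -?EFinB ?ltry// lte_fin subr_gt0.
Qed.

Lemma positive_finite_setX d1 d2 (T1 : measurableType d1)
    (T2 : measurableType d2)
    (m1 : {sigma_finite_measure set T1 -> \bar R})
    (m2 : {sigma_finite_measure set T2 -> \bar R}) (A : set T1) (B : set T2) :
  positive_finite m1 A -> positive_finite m2 B ->
  positive_finite (prod_measure m1 m2) (A `*` B).
Proof.
move=> [mA A0 Aoo] [mB B0 Boo].
have E : prod_measure m1 m2 (A `*` B) = (m1 A * m2 B)%E.
  exact: product_measure1E.
split; [exact: measurableX|by rewrite E mule_gt0|rewrite E].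
by rewrite lte_mul_pinfty// ?ge0_fin_numE.
Qed.

Lemma positive_finite_tuple d (T : measurableType d)
    (mu : {sigma_finite_measure set T -> \bar R}) (A : set T) (m : nat) :
  positive_finite mu A ->
  positive_finite (tuple_measure mu m)
    [set u : m.-tuple T | forall l, A (tnth u l)].
Proof.
move=> hA; elim: m => [|m ih].
  rewrite (_ : [set u | _] = setT); last first.
    by apply/seteqP; split => u // _ [].
  by split => //=; rewrite diracT ?lte01 ?ltry.
have mcons : measurable [set u : m.+1.-tuple T | forall l, A (tnth u l)].
  rewrite (_ : [set u | _] = \bigcap_(l in [set: 'I_m.+1])
    ((fun u : m.+1.-tuple T => tnth u l) @^-1` A)).
    apply: fin_bigcap_measurable => // l _; apply: measurable_preimage.
      exact: measurable_tnth.
    by case: hA.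
  by apply/seteqP; split => u /= h l; [move=> _; exact: h|exact: (h l I)].
have [_ p0 poo] := positive_finite_setX hA ih.
set B := [set u | _] in mcons *.
have E : tuple_measure mu m.+1 B =
    prod_measure mu (tuple_measure mu m) (@tuple_cons _ T m @^-1` B) by [].
have BE : @tuple_cons _ T m @^-1` B =
    A `*` [set u : m.-tuple T | forall l, A (tnth u l)].
  apply/seteqP; split => -[x u] /=.
    move=> h; split => [|l]; first by have := h ord0; rewrite (tnth_nth x).
    by have := h (lift ord0 l); rewrite !(tnth_nth x).
  move=> [Ax Au] l; case: (unliftP ord0 l) => [j ->|->].
    by have := Au j; rewrite !(tnth_nth x).
  by rewrite (tnth_nth x).
by split => //; rewrite E BE.
Qed.

Definition quat_box (a b : R) : set (quat R) :=
  `[a, b] `*` (`[a, b] `*` `[a, b] `*` `[a, b]).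

Definition heis_box (m : nat) (a b c d : R) : set (heis R m) :=
  (`[a, b] `*` `[a, b] `*` `[a, b]) `*`
  [set y | forall l, quat_box c d (tnth y l)].

Lemma positive_finite_heis_box (m : nat) (a b c d : R) : a < b -> c < d ->
  positive_finite (@heis_leb R m) (heis_box a b c d).
Proof.
move=> ab cd; have Iab := positive_finite_itv ab.
have Icd := positive_finite_itv cd.
apply: positive_finite_setX.
  exact: positive_finite_setX (positive_finite_setX Iab Iab) Iab.
apply: positive_finite_tuple; apply: positive_finite_setX => //.
exact: positive_finite_setX (positive_finite_setX Icd Icd) Icd.
Qed.
End FiniteBoxes.

(** * The quaternionic Heisenberg group *)

Section HeisenbergNorm.
Context {R : realType}.
Implicit Types (q : quat R) (t : imquat R).

(** Root-free versions of the norms, polynomial in the coordinates: [qsq], [imqsq] and [vsq] are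
    squared norms, while [hsq] is the fourth power of [hnorm]. *)
Definition qsq q : R := q.1 ^+ 2 + q.2.1.1 ^+ 2 + q.2.1.2 ^+ 2 + q.2.2 ^+ 2.
Definition imqsq t : R := t.1.1 ^+ 2 + t.1.2 ^+ 2 + t.2 ^+ 2.

Lemma qsq_ge0 q : 0 <= qsq q.
Proof. by rewrite !addr_ge0 ?sqr_ge0. Qed.

Lemma imqsq_ge0 t : 0 <= imqsq t.
Proof. by rewrite !addr_ge0 ?sqr_ge0. Qed.

Lemma qnorm_sqr q : qnorm q ^+ 2 = qsq q.
Proof. by rewrite sqr_sqrtr// qsq_ge0. Qed.

Lemma imqnorm_sqr t : imqnorm t ^+ 2 = imqsq t.
Proof. by rewrite sqr_sqrtr// imqsq_ge0. Qed.

Context {m : nat}.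
Implicit Types (y : m.-tuple (quat R)) (g h w : heis R m).

Definition vsq y : R := \sum_(l < m) qsq (tnth y l).
Definition hsq g : R := vsq g.2 ^+ 2 + imqsq g.1.

Lemma vsq_ge0 y : 0 <= vsq y.
Proof. by apply: sumr_ge0 => l _; exact: qsq_ge0. Qed.

Lemma vnorm_sqr y : vnorm y ^+ 2 = vsq y.
Proof.
rewrite sqr_sqrtr; first by apply: eq_bigr => l _; rewrite qnorm_sqr.
by apply: sumr_ge0 => l _; exact: sqr_ge0.
Qed.

Lemma vnorm_ge0 y : 0 <= vnorm y.
Proof. exact: sqrtr_ge0. Qed.

Lemma hnorm_ge0 g : 0 <= hnorm g.
Proof. exact: powR_ge0. Qed.

Lemma hnorm_pow4 g : hnorm g ^+ 4 = hsq g.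
Proof.
rewrite /hnorm -powR_mulrn ?powR_ge0// -powRrM mulVf ?pnatr_eq0// powRr1.
  by rewrite imqnorm_sqr (exprM _ 2 2) vnorm_sqr.
by rewrite addr_ge0 ?exprn_ge0 ?vnorm_ge0 ?sqr_ge0// sqrtr_ge0.
Qed.

Lemma hnorm_lt g (r : R) : 0 <= r -> (hnorm g < r) = (hsq g < r ^+ 4).
Proof. by move=> r0; rewrite -hnorm_pow4 ltr_pXn2r// nnegrE hnorm_ge0. Qed.

Lemma vnorm_le_hnorm g : vnorm g.2 <= hnorm g.
Proof.
rewrite -(@ler_pXn2r _ 4)// ?nnegrE ?vnorm_ge0 ?hnorm_ge0// hnorm_pow4.
by rewrite (exprM _ 2 2) vnorm_sqr lerDl imqsq_ge0.
Qed.

Lemma hform_coord i y y' : imcoord i (qim (hform y y')) =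
  \sum_(l < m) imcoord i (qim (qmul (qconj (tnth y l)) (tnth y' l))).
Proof.
by apply: (big_morph (imcoord i \o qim)) => [a b|]; [exact: imcoordD|case: i].
Qed.

Lemma imcoord_hmul i g h : imcoord i (hmul g h).1 =
  imcoord i g.1 + imcoord i h.1 + 2 * imcoord i (qim (hform g.2 h.2)).
Proof. by rewrite !imcoordD imcoordZ. Qed.

Lemma imcoord_hinv i g : imcoord i (hinv g).1 = - imcoord i g.1.
Proof. exact: imcoordN. Qed.

Lemma heisP g h : (forall i, imcoord i g.1 = imcoord i h.1) ->
  (forall l, tnth g.2 l = tnth h.2 l) -> g = h.
Proof.
case: g h => [t y] [t' y'] /= tE yE.
by rewrite (imcoordP tE) (eq_from_tnth yE).
Qed.

Lemma hsq_hinv g : hsq (hinv g) = hsq g.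
Proof.
rewrite /hsq /hinv /vsq /=; congr (_ ^+ 2 + _).
  by apply: eq_bigr => l _; rewrite tnth_mktuple /qsq /= !sqrrN.
by rewrite /imqsq /= !sqrrN.
Qed.

(** The imaginary part of the form is antisymmetric, since exchanging its arguments conjugates it.
    This yields the symmetry of the quasi-distance. *)
Lemma hmul_inv_inv g h : hmul (hinv g) h = hinv (hmul (hinv h) g).
Proof.
apply: heisP => [i|l]; last by rewrite !tnth_mktuple /= opprD opprK addrC.
rewrite imcoord_hinv !imcoord_hmul !imcoord_hinv.
rewrite (_ : imcoord i (qim (hform (hinv g).2 h.2)) =
  - imcoord i (qim (hform (hinv h).2 g.2))); first ring.
rewrite !hform_coord -sumrN; apply: eq_bigr => l _; rewrite !tnth_mktuple.
by case: i; rewrite /qmul /qconj /qre /qim /qi /qj /qk /=; ring.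
Qed.

Lemma hmulKV g h : hmul (hinv g) (hmul g h) = h.
Proof.
apply: heisP => [i|l]; last by rewrite !tnth_mktuple addrA addNr add0r.
rewrite !imcoord_hmul imcoord_hinv.
rewrite (_ : imcoord i (qim (hform (hinv g).2 (hmul g h).2)) =
  - imcoord i (qim (hform g.2 h.2))); first ring.
rewrite !hform_coord -sumrN; apply: eq_bigr => l _; rewrite !tnth_mktuple.
by case: i; rewrite /qmul /qconj /qre /qim /qi /qj /qk /=; ring.
Qed.

(** Left invariance, checked directly in coordinates; it moves the base point g to the neutral
    element. *)
Lemma hmul_hinv_mul g g1 g2 :
  hmul (hinv g2) g1 = hmul (hinv (hmul (hinv g) g2)) (hmul (hinv g) g1).
Proof.
apply: heisP => [i|l]; last first.
  by rewrite !tnth_mktuple /= opprD opprK addrACA subrr add0r.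
rewrite !(imcoord_hmul, imcoord_hinv).
rewrite (_ : imcoord i (qim (hform (hinv g2).2 g1.2)) =
  - imcoord i (qim (hform (hinv g).2 g2.2)) +
  imcoord i (qim (hform (hinv g).2 g1.2)) +
  imcoord i (qim (hform (hinv (hmul (hinv g) g2)).2 (hmul (hinv g) g1).2))).
  by ring.
rewrite !hform_coord -sumrN -!big_split; apply: eq_bigr => l _.
rewrite !tnth_mktuple.
by case: i; rewrite /qmul /qconj /qre /qim /qi /qj /qk /=; ring.
Qed.

End HeisenbergNorm.

(** * Stability of the cone under perturbation by the unit ball *)

Section Geometry.
Context {R : realType} {m : nat}.
Implicit Types (g h w u : heis R m).

(** The difference of the two sides is e times the sum of the squares (a_i - b_i / e)^2. *)
Lemma young4 (e a1 a2 a3 a4 b1 b2 b3 b4 : R) : 0 < e ->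
  2 * (a1 * b1 + a2 * b2 + a3 * b3 + a4 * b4) <=
  e * (a1 ^+ 2 + a2 ^+ 2 + a3 ^+ 2 + a4 ^+ 2) +
  e^-1 * (b1 ^+ 2 + b2 ^+ 2 + b3 ^+ 2 + b4 ^+ 2).
Proof.
move=> e0; rewrite -subr_ge0.
rewrite (_ : _ - _ = e * ((a1 - e^-1 * b1) ^+ 2 + (a2 - e^-1 * b2) ^+ 2 +
  (a3 - e^-1 * b3) ^+ 2 + (a4 - e^-1 * b4) ^+ 2)); last first.
  by field; exact: lt0r_neq0.
by rewrite mulr_ge0 ?(ltW e0)// !addr_ge0// sqr_ge0.
Qed.

(** Each imaginary coordinate of the product is a signed sum of four terms pairing the coordinates
    of q with those of q'; Young's inequality with the two opposite sign choices bounds it on both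
    sides. *)
Lemma qim_qmul_bound (e : R) (i : axis) (q q' : quat R) : 0 < e ->
  `|2 * imcoord i (qim (qmul (qconj q) q'))| <= e * qsq q + e^-1 * qsq q'.
Proof.
move=> e0; move: q q' => [a [[b c] d]] [a' [[b' c'] d']].
case: i; rewrite /imcoord /qsq /qmul /qconj /qre /qim /qi /qj /qk /=;
  rewrite ler_norml; apply/andP; split.
- have := young4 (- a) b c (- d) b' a' d' c' e0; rewrite !sqrrN; lra.
- have := young4 a (- b) (- c) d b' a' d' c' e0; rewrite !sqrrN; lra.
- have := young4 (- a) (- b) c d c' d' a' b' e0; rewrite !sqrrN; lra.
- have := young4 a b (- c) (- d) c' d' a' b' e0; rewrite !sqrrN; lra.
- have := young4 (- a) b (- c) d d' c' b' a' e0; rewrite !sqrrN; lra.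
- have := young4 a (- b) c (- d) d' c' b' a' e0; rewrite !sqrrN; lra.
Qed.

Lemma hform_bound (e : R) (i : axis) (y y' : m.-tuple (quat R)) : 0 < e ->
  `|2 * imcoord i (qim (hform y y'))| <= e * vsq y + e^-1 * vsq y'.
Proof.
move=> e0; rewrite hform_coord mulr_sumr.
apply: (le_trans (ler_norm_sum _ _ _)).
rewrite /vsq !mulr_sumr -big_split; apply: ler_sum => l _.
exact: qim_qmul_bound.
Qed.

Lemma imcoord_sqr_le (i : axis) (t : imquat R) : imcoord i t ^+ 2 <= imqsq t.
Proof.
have := (sqr_ge0 t.1.1, sqr_ge0 t.1.2, sqr_ge0 t.2).
by rewrite /imqsq => -[[? ?] ?]; case: i => /=; lra.
Qed.

Lemma vsq_hinv g : vsq (hinv g).2 = vsq g.2.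
Proof. by apply: eq_bigr => l _; rewrite tnth_mktuple /qsq /= !sqrrN. Qed.

(** Coordinatewise, (s + t)^2 - s^2 / 2 + t^2 = (s + 2 t)^2 / 2. *)
Lemma vsq_hmul_lower g h : vsq g.2 / 2 - vsq h.2 <= vsq (hmul g h).2.
Proof.
rewrite /vsq mulr_suml -sumrB; apply: ler_sum => l _; rewrite tnth_mktuple.
set a := tnth _ _; set b := tnth _ _; rewrite /qsq /=.
have H (s t : R) : s ^+ 2 / 2 - t ^+ 2 <= (s + t) ^+ 2.
  by have := sqr_ge0 (s + 2 * t); nra.
have := H a.1 b.1; have := H a.2.1.1 b.2.1.1; have := H a.2.1.2 b.2.1.2.
have := H a.2.2 b.2.2; lra.
Qed.

Lemma abs_le_of_sqr (a B : R) : 0 <= B -> a ^+ 2 <= B ^+ 2 -> `|a| <= B.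
Proof.
move=> B0 aB; rewrite -(@ler_pXn2r _ 2)// ?nnegrE//.
by rewrite real_normK ?num_real.
Qed.

(** With x = [vsq w.2] >= 4, the horizontal part satisfies [vsq h.2] >= x / 2 - 1 >= x / 4. Each
    central coordinate is at most 12 e [vsq h.2], and summing three squares gives 432 = 3 * 12^2. *)
Lemma sector_stable (e : R) w u : 0 < e -> 4 <= vsq w.2 ->
  1 + e^-1 <= e * vsq w.2 -> imqsq w.1 <= e ^+ 2 * vsq w.2 ^+ 2 ->
  hsq u <= 1 -> let h := hmul (hinv w) u in
  0 < vsq h.2 /\ imqsq h.1 <= 432 * e ^+ 2 * vsq h.2 ^+ 2.
Proof.
move=> e0 x4 ex wt u1 h.
have v0 := vsq_ge0 u.2; have i0 := imqsq_ge0 u.1.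
have v1 : vsq u.2 <= 1 by move: u1; rewrite /hsq; nra.
have i1 : imqsq u.1 <= 1 ^+ 2 by move: u1; rewrite /hsq expr1n; nra.
have hx : vsq w.2 / 4 <= vsq h.2.
  by have := vsq_hmul_lower (hinv w) u; rewrite vsq_hinv -/h; lra.
have h0 : 0 < vsq h.2 by lra.
split => //.
have e1 : 0 < e^-1 by rewrite invr_gt0.
have H i : imcoord i h.1 ^+ 2 <= (12 * e * vsq h.2) ^+ 2.
  have := hform_bound i (hinv w).2 u.2 e0; rewrite vsq_hinv => f.
  have tw : `|imcoord i w.1| <= e * vsq w.2.
    apply: abs_le_of_sqr; first by rewrite mulr_ge0 ?vsq_ge0 ?ltW.
    by rewrite exprMn (le_trans (imcoord_sqr_le i _)).
  have tu : `|imcoord i u.1| <= 1.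
    by apply: abs_le_of_sqr => //; exact: le_trans (imcoord_sqr_le i _) i1.
  have ve : e^-1 * vsq u.2 <= e^-1 by rewrite ger_pMr.
  have : `|imcoord i h.1| <= 12 * e * vsq h.2.
    (* Three contributions of size at most e x: the central part of w, the term e x from Young's
       inequality, and 1 + e^-1, which collects the central part of u and the other Young term. *)
    apply: (@le_trans _ _ (3 * (e * vsq w.2))); last first.
      have : e * (vsq w.2 / 4) <= e * vsq h.2 by rewrite ler_pM2l.
      lra.
    rewrite imcoord_hmul imcoord_hinv.
    move: f tw tu; rewrite !ler_norml => /andP[? ?] /andP[? ?] /andP[? ?].
    by apply/andP; split; lra.
  by rewrite ler_norml => /andP[? ?]; nra.
have := (H AxisI, H AxisJ, H AxisK); rewrite /imqsq !exprMn => -[[/= ? ?] ?].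
lra.
Qed.
End Geometry.

(** * Dilations, balls and cones *)

Section HomogeneousSets.
Context {R : realType} {m : nat}.
Implicit Types (g h w : heis R m) (D : set (heis R m)).
Local Notation mu := (@heis_leb R m).
Local Notation Q := (4 * m + 6)%N.

Lemma measurable_quat_coords :
  measurable_fun setT (fun q : quat R => q.1 : R) /\
  forall i, measurable_fun setT (fun q : quat R => imcoord i (qim q)).
Proof.
split=> [|i]; first exact: measurable_fst.
exact: (measurableT_comp (measurable_imcoord i) measurable_snd).
Qed.

Lemma measurable_hform_coord (i : axis) (u : m.-tuple (quat R)) :
  measurable_fun setT (fun y => imcoord i (qim (hform u y))).
Proof.
have [m1 mi] := measurable_quat_coords.
have [[m2 m3] m4] := (mi AxisI, mi AxisJ, mi AxisK).
have M (q : quat R) :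
    measurable_fun setT (fun q' => imcoord i (qim (qmul q q'))).
  case: i; rewrite /qmul /qre /qim /qi /qj /qk /=;
  do !apply: measurable_funD => //; do ?apply: measurableT_comp => //;
    exact: measurable_funM.
under eq_fun do rewrite hform_coord.
apply: measurable_sum => l.
exact: (measurableT_comp (M (qconj (tnth u l))) (measurable_tnth l)).
Qed.

Lemma scales_hmul g : scales_measure mu (hmul g) 1.
Proof.
have mk i : measurable_fun setT
    (fun y => imcoord i (g.1 + 2 *: qim (hform g.2 y))).
  under eq_fun do rewrite imcoordD imcoordZ.
  apply: measurable_funD => //; apply: measurable_funM => //.
  exact: measurable_hform_coord.
have := heis_affine g.2 ltr01 ltr01 mk; rewrite !expr1n !invr1 mulr1.
rewrite (_ : (fun _ => _) = hmul g)//; apply/funext => h; congr pair.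
  by rewrite scale1r addrA [h.1 + _]addrC.
by apply: eq_from_tnth => l; rewrite !tnth_mktuple scale1r addrC.
Qed.

(** The centre scales by r^2, so that the homogeneous norm scales by r; the Jacobian exponent is 2 *
    3 + 4 m = Q. *)
Definition hdil (r : R) g : heis R m :=
  (r ^+ 2 *: g.1, [tuple r *: tnth g.2 l | l < m]).

Lemma scales_hdil (r : R) : 0 < r -> scales_measure mu (hdil r) (r ^- Q).
Proof.
move=> r0.
have mk i : measurable_fun setT
    (fun _ : m.-tuple (quat R) => imcoord i (0 : imquat R)) by [].
have := heis_affine [tuple of nseq m 0] r0 (exprn_gt0 2 r0) mk.
rewrite -exprM -invfM -exprD addnC.
rewrite (_ : (fun _ => _) = hdil r)//.
apply/funext => g; congr pair; first by rewrite addr0.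
by apply: eq_from_tnth => l; rewrite !tnth_mktuple tnth_nseq addr0.
Qed.

Let scaler_regE (a b : R) : a *: b = a * b. Proof. by []. Qed.

Lemma vsq_hdil (r : R) g : vsq (hdil r g).2 = r ^+ 2 * vsq g.2.
Proof.
rewrite /vsq mulr_sumr; apply: eq_bigr => l _.
by rewrite tnth_mktuple /qsq /= !scaler_regE; ring.
Qed.

Lemma imqsq_hdil (r : R) g : imqsq (hdil r g).1 = r ^+ 4 * imqsq g.1.
Proof. by rewrite /imqsq /= !scaler_regE; ring. Qed.

Lemma hsq_hdil (r : R) g : hsq (hdil r g) = r ^+ 4 * hsq g.
Proof. by rewrite /hsq vsq_hdil imqsq_hdil; ring. Qed.

Lemma measurable_vsq : measurable_fun setT (fun g : heis R m => vsq g.2 : R).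
Proof.
have [m1 mi] := measurable_quat_coords.
have mq : measurable_fun setT (fun q : quat R => qsq q).
  apply: measurable_funD; last exact: measurable_funX (mi AxisK).
  apply: measurable_funD; last exact: measurable_funX (mi AxisJ).
  apply: measurable_funD; last exact: measurable_funX (mi AxisI).
  exact: measurable_funX m1.
apply: measurable_sum => l.
have ml := measurableT_comp mq (measurable_tnth l).
exact: (measurableT_comp ml measurable_snd).
Qed.

Lemma measurable_imqsq :
  measurable_fun setT (fun g : heis R m => imqsq g.1 : R).
Proof.
apply: (measurableT_comp (f := imqsq)); last exact: measurable_fst.
apply: measurable_funD; last exact: measurable_funX (measurable_imcoord AxisK).
apply: measurable_funD; last exact: measurable_funX (measurable_imcoord AxisJ).
exact: measurable_funX (measurable_imcoord AxisI).
Qed.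

Lemma measurable_hsq : measurable_fun setT (hsq : heis R m -> R).
Proof.
apply: measurable_funD; last exact: measurable_imqsq.
exact: measurable_funX measurable_vsq.
Qed.

Definition hnorm_ball (r : R) : set (heis R m) := [set w | hsq w < r ^+ 4].

Lemma measurable_hnorm_ball (r : R) : measurable (hnorm_ball r).
Proof.
rewrite (_ : hnorm_ball r = hsq @^-1` `]-oo, r ^+ 4[); last first.
  by apply/seteqP; split => w /=; rewrite in_itv.
exact: measurable_preimage measurable_hsq _.
Qed.

Definition dilation_invariant D : Prop :=
  forall r : R, 0 < r -> hdil r @^-1` D = D.

(** The dilation by r pulls D and the ball of radius r back to D and the unit ball. *)
Lemma measure_homogeneous_ball D (r : R) : measurable D ->
  dilation_invariant D -> 0 < r ->
  mu (D `&` hnorm_ball r) = ((r ^+ Q)%:E * mu (D `&` hnorm_ball 1))%E.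
Proof.
move=> mD iD r0; have [_ _ H] := scales_hdil r0.
have := H (D `&` hnorm_ball r) (measurableI _ _ mD (measurable_hnorm_ball r)).
rewrite preimage_setI iD// (_ : _ @^-1` _ = hnorm_ball 1); last first.
  apply/seteqP; split => w; rewrite /hnorm_ball /= hsq_hdil expr1n;
    by rewrite -{2}[r ^+ 4]mulr1 ltr_pM2l ?exprn_gt0.
by move=> ->; rewrite muleA -EFinM mulfV ?mul1e// expf_neq0// gt_eqF.
Qed.

Lemma hnorm_ball1_finite : (mu (hnorm_ball 1) < +oo)%E.
Proof.
have lt11 : -1 < 1 :> R by lra.
have [mB _ Boo] := @positive_finite_heis_box R m _ _ _ _ lt11 lt11.
apply: le_lt_trans Boo; apply: le_measure; rewrite ?inE//.
  exact: measurable_hnorm_ball.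
move=> w; rewrite /hnorm_ball /= expr1n => w1.
have B1 (a : R) : a ^+ 2 <= 1 -> a \in `[-1, 1].
  by move=> a1; rewrite in_itv /=; apply/andP; split; nra.
have i0 := imqsq_ge0 w.1; have v0 := vsq_ge0 w.2.
have i1 : imqsq w.1 <= 1 by move: w1; rewrite /hsq; nra.
have v1 : vsq w.2 <= 1 by move: w1; rewrite /hsq; nra.
split => [|l].
  move: i1; rewrite /imqsq => i1.
  have [s1 s2 s3] : [/\ 0 <= w.1.1.1 ^+ 2, 0 <= w.1.1.2 ^+ 2 & 0 <= w.1.2 ^+ 2].
    by split; exact: sqr_ge0.
  by split; [split|]; apply: B1; lra.
have : qsq (tnth w.2 l) <= 1.
  apply: le_trans v1; rewrite /vsq (bigD1 l)//= lerDl.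
  by apply: sumr_ge0 => k _; exact: qsq_ge0.
set q := tnth _ _; rewrite /qsq => q1.
have [s1 s2 s3 s4] : [/\ 0 <= q.1 ^+ 2, 0 <= q.2.1.1 ^+ 2,
    0 <= q.2.1.2 ^+ 2 & 0 <= q.2.2 ^+ 2] by split; exact: sqr_ge0.
by split; [|split; [split|]]; apply: B1; lra.
Qed.
End HomogeneousSets.

(** * Measure of cones in balls and annuli *)

Section Cones.
Context {R : realType} {m : nat}.
Implicit Types (g h w : heis R m) (D : set (heis R m)).
Local Notation mu := (@heis_leb R m).
Local Notation Q := (4 * m + 6)%N.

Lemma homogeneous_ball_finite D (r : R) : measurable D ->
  dilation_invariant D -> 0 < r -> (mu (D `&` hnorm_ball r) < +oo)%E.
Proof.
move=> mD iD r0; rewrite measure_homogeneous_ball//.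
have B : (mu (D `&` hnorm_ball 1) < +oo)%E.
  apply: le_lt_trans hnorm_ball1_finite.
  apply: le_measure; rewrite ?inE.
  - exact: measurableI mD (measurable_hnorm_ball 1).
  - exact: measurable_hnorm_ball.
  - exact: subIsetr.
by rewrite lte_mul_pinfty ?lee_fin ?exprn_ge0 ?ltW.
Qed.

Lemma hnorm_ball_subset (r1 r2 : R) : 0 <= r1 -> r1 <= r2 ->
  hnorm_ball r1 `<=` (hnorm_ball r2 : set (heis R m)).
Proof.
move=> r10 r12 w /lt_le_trans; apply.
by rewrite lerXn2r// nnegrE// (le_trans r10).
Qed.

Lemma measure_homogeneous_annulus D (r1 r2 : R) : measurable D ->
  dilation_invariant D -> 0 < r1 -> r1 < r2 ->
  mu (D `&` (hnorm_ball r2 `\` hnorm_ball r1)) =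
  ((r2 ^+ Q - r1 ^+ Q)%:E * mu (D `&` hnorm_ball 1))%E.
Proof.
move=> mD iD r10 r12; have r20 := lt_trans r10 r12.
have mB r : measurable (D `&` hnorm_ball r).
  exact: measurableI mD (measurable_hnorm_ball r).
rewrite setIDA measureD//; last 2 first.
- exact: measurable_hnorm_ball.
- exact: homogeneous_ball_finite.
rewrite -setIA (setIidr (hnorm_ball_subset (ltW r10) (ltW r12))).
rewrite [X in (X - _)%E](measure_homogeneous_ball mD iD r20).
rewrite [X in (_ - X)%E](measure_homogeneous_ball mD iD r10).
rewrite EFinB muleBl//.
rewrite ge0_fin_numE//.
by have := homogeneous_ball_finite mD iD (@ltr01 R).
Qed.

(** Both sides scale by r^4 under dilations, which makes the cone dilation-invariant. *)
Definition hcone (e : R) : set (heis R m) :=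
  [set w | imqsq w.1 <= e * vsq w.2 ^+ 2].

Lemma measurable_hcone (e : R) : measurable (hcone e).
Proof.
pose f (w : heis R m) : R := e * vsq w.2 ^+ 2 - imqsq w.1.
have mf : measurable_fun setT f.
  apply: measurable_funB; last exact: measurable_imqsq.
  by apply: measurable_funM => //; exact: measurable_funX measurable_vsq.
rewrite (_ : hcone e = f @^-1` `[0, +oo[); last first.
  by apply/seteqP; split => w /=; rewrite in_itv /= andbT subr_ge0.
exact: measurable_preimage mf _.
Qed.

Lemma hcone_dilation_invariant (e : R) : dilation_invariant (hcone e).
Proof.
move=> r r0.
have E w : (imqsq (hdil r w).1 <= e * vsq (hdil r w).2 ^+ 2) =
    (imqsq w.1 <= e * vsq w.2 ^+ 2).
  by rewrite vsq_hdil imqsq_hdil exprMn -exprM mulrCA ler_pM2l ?exprn_gt0.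
by apply/seteqP; split => w; rewrite /hcone /= E.
Qed.

(** A box with t near 0 and all coordinates of y in [1, 2] has positive measure and lies in the cone
    and in some large ball; homogeneity carries positivity back to the unit ball. *)
Lemma hcone_ball_gt0 (e : R) : (0 < m)%N -> 0 < e ->
  (0 < mu (hcone e `&` hnorm_ball 1))%E.
Proof.
(* On the box |t|^2 <= 3 d^2 <= 3 d <= e, while |y|^2 >= 1. *)
move=> m0 e0; pose d : R := Num.min 1 (e / 3).
have d0 : 0 < d by rewrite lt_min ltr01 divr_gt0.
have d1 : d <= 1 by rewrite ge_min lexx.
have de : 3 * d <= e by have : d <= e / 3 by [rewrite ge_min lexx orbT]; lra.
have lt12 : 1 < 2 :> R by lra.
have [mB B0 _] := @positive_finite_heis_box R m _ _ _ _ d0 lt12.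
(* On the box |y|^2 <= 16 m and |t|^2 <= 3, so [hsq] is at most (16 m)^2 + 3 < r^2 <= r^4. *)
pose r : R := 16 * m%:R + 4.
have r0 : 0 < r by rewrite ltr_wpDl// mulr_ge0.
suff sub : heis_box 0 d 1 2 `<=` hcone e `&` hnorm_ball r.
  have : (0 < mu (hcone e `&` hnorm_ball r))%E.
    apply: lt_le_trans B0 _; apply: le_measure; rewrite ?inE//.
    exact: measurableI (measurable_hcone e) (measurable_hnorm_ball r).
  rewrite measure_homogeneous_ball//; last 2 first.
  - exact: measurable_hcone.
  - exact: hcone_dilation_invariant.
  by rewrite pmule_rgt0// lte_fin exprn_gt0.
move=> w [/= [[+ +] +] hq]; rewrite /= !in_itv /=.
move=> /andP[a0 ad] /andP[b0 bd] /andP[c0 cd].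
have tle : imqsq w.1 <= 3 * d ^+ 2.
  rewrite /imqsq.
  have : w.1.1.1 ^+ 2 <= d ^+ 2 by rewrite lerXn2r// nnegrE ltW.
  have : w.1.1.2 ^+ 2 <= d ^+ 2 by rewrite lerXn2r// nnegrE ltW.
  have : w.1.2 ^+ 2 <= d ^+ 2 by rewrite lerXn2r// nnegrE ltW.
  lra.
have dd : d ^+ 2 <= d by rewrite expr2; nra.
have qb l : 1 <= qsq (tnth w.2 l) <= 16.
  have [+ [[+ +] +]] := hq l; rewrite /= !in_itv /= /qsq.
  set q := tnth _ _ => /andP[? ?] /andP[? ?] /andP[? ?] /andP[? ?].
  by apply/andP; split; nra.
have v1 : 1 <= vsq w.2.
  rewrite /vsq (bigD1 (Ordinal m0))//=.
  have /andP[? _] := qb (Ordinal m0).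
  have : 0 <= \sum_(i < m | i != Ordinal m0) qsq (tnth w.2 i).
    by apply: sumr_ge0 => k _; exact: qsq_ge0.
  lra.
have v2 : vsq w.2 <= 16 * m%:R.
  rewrite /vsq; apply: (@le_trans _ _ (\sum_(l < m) (16 : R))).
    by apply: ler_sum => l _; have /andP[] := qb l.
  by rewrite sumr_const card_ord mulr_natr.
split; rewrite /hcone /hnorm_ball /=.
  apply: (le_trans tle); apply: (@le_trans _ _ e); first lra.
  by rewrite ler_peMr ?(ltW e0)// exprn_ege1.
have : hsq w <= (16 * m%:R) ^+ 2 + 3.
  by rewrite /hsq lerD//; [rewrite lerXn2r// nnegrE ?mulr_ge0// vsq_ge0|lra].
move/le_lt_trans; apply; rewrite -/r.
have mr : 1 <= m%:R :> R by rewrite ler1n.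
have r1 : (16 * m%:R) ^+ 2 + 3 < r ^+ 2 by rewrite /r; nra.
apply: (lt_le_trans r1).
rewrite (_ : r ^+ 4 = r ^+ 2 * r ^+ 2); last by rewrite -exprD.
have r1' : 1 <= r by rewrite /r; lra.
by rewrite ler_peMr ?sqr_ge0// exprn_ege1.
Qed.

End Cones.

(** * The Cauchy-Szego kernel *)

Section KernelDerivatives.
Context {R : realType}.

(* [kfun b i k] is the [k]-th derivative on x > 0 of x / (x^2 + b)^2 for
   [i = 2] and of 1 / (x^2 + b)^2 for [i = 3]; with u = b / x^2 it equals
   x^-(k + i + 1) p(u) (1 + u)^-(k + 2), and the recursion defining
   p = [kpoly i k] is the one obtained by differentiating this product. *)
Fixpoint kpoly (i k : nat) : {poly R} :=
  if k is k'.+1 then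
    let p := kpoly i k' in
    - ((k' + i).+1%:R *: ((1 + 'X) * p))
    - 2 *: ('X * ((1 + 'X) * p^`() - k'.+2%:R *: p))
  else 1.

Definition kfun (b : R) (i k : nat) (x : R) : R :=
  x^-1 ^+ (k + i).+1 * (kpoly i k).[b * x^-1 ^+ 2] *
  (1 + b * x^-1 ^+ 2)^-1 ^+ k.+2.

(** With z = 1/x, v = b z^2 and w = 1/(1 + v), one has z' = - z^2, v' = - 2 b z^3 and w' = 2 b z^3
    w^2; the product rule then reproduces the recursion of [kpoly]. *)
Lemma is_derive_kfun (b : R) (i k : nat) (x : R) : 0 <= b -> 0 < x ->
  is_derive x (1 : R) (kfun b i k) (kfun b i k.+1 x).
Proof.
move=> b0 x0; have sE (a c : R) : a *: c = a * c by [].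
pose z : R -> R := fun y => y^-1.
have dz : is_derive x (1 : R) z (- z x ^+ 2).
  have := @is_deriveV R id x 1 1 (lt0r_neq0 x0) (is_derive_id _ _).
  by rewrite /z /= [_ *: _]mulr1 ?exprVn.
pose v : R -> R := fun y => b * z y ^+ 2.
have dv : is_derive x (1 : R) v (- (2 * b * z x ^+ 3)).
  have -> : v = b \*: (z ^+ 2) by apply/funext => y.
  by apply: is_derive_eq; rewrite /= !sE; ring.
have v0 : 0 < 1 + v x by rewrite ltr_pwDl// mulr_ge0 ?sqr_ge0.
pose w : R -> R := fun y => (1 + v y)^-1.
have dw : is_derive x (1 : R) w (2 * b * z x ^+ 3 * w x ^+ 2).
  have d1v : is_derive x (1 : R) (cst 1 + v) (- (2 * b * z x ^+ 3)).
    by apply: is_derive_eq; rewrite add0r.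
  have H := @is_deriveV R (cst 1 + v) x _ 1 (lt0r_neq0 v0) d1v.
  apply: (is_derive_eq H); rewrite sE /w /= ?exprVn; ring.
set p := kpoly i k.
have dp : is_derive x (1 : R) (horner p \o v)
    (p^`().[v x] * - (2 * b * z x ^+ 3)).
  exact: (is_derive1_comp (is_derive_poly p (v x)) dv).
have -> : kfun b i k = (z ^+ (k + i).+1 * (horner p \o v)) * w ^+ k.+2.
  by apply/funext => y; rewrite /kfun !fctE.
have dzn := is_deriveX (k + i).+1 dz.
have dwn := is_deriveX k.+2 dw.
have D := is_deriveM (is_deriveM dzn dp) dwn.
apply: (is_derive_eq D).
have pE : (kpoly i k.+1).[v x] = - ((k + i).+1%:R * ((1 + v x) * p.[v x])) -
    2 * (v x * ((1 + v x) * p^`().[v x] - k.+2%:R * p.[v x])).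
  by rewrite /= !hornerE; ring.
(* Raising the power of w gives all terms of the product rule the common factor w^(k+3), leaving a
   polynomial identity. *)
have hw : w x ^+ k.+2 = w x ^+ k.+3 * (1 + v x).
  by rewrite [w x ^+ k.+3]exprSr -mulrA mulVf ?mulr1// lt0r_neq0.
rewrite [RHS](_ : _ = z x ^+ (k + i).+2 * (kpoly i k.+1).[v x] *
  w x ^+ k.+3)// pE !fctE !sE /= -!/(GRing.exp _ _) hw.
rewrite (_ : w x ^+ k.+3 = w x ^+ k.+1 * w x ^+ 2); last first.
  by rewrite -exprD addn2.
rewrite [z x ^+ (k + i).+2]exprS ![z x ^+ (k + i).+1]exprS.
move: (z x ^+ (k + i)) (w x ^+ k.+1) (p.[v x]) (p^`().[v x]) => Z W P dP.
rewrite /v; ring.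
Qed.

Lemma is_derive_pair (V W : normedModType R) (f : R -> V) (g : R -> W)
    (x : R) (df : V) (dg : W) :
  is_derive x (1 : R) f df -> is_derive x (1 : R) g dg ->
  is_derive x (1 : R) (fun y => (f y, g y)) (df, dg).
Proof.
move=> [ff <-] [gg <-].
have ff' := ff; have gg' := gg.
move: ff' gg' => /derivable1_diffP ff' /derivable1_diffP gg'.
have fg := differentiable_pair ff' gg'.
apply: DeriveDef; first exact/derivable1_diffP.
by rewrite !deriveE// diff_pair.
Qed.

(** At 0 the recursion is multiplication by -(k + i + 1), so the value is (-1)^k (k + i)! / i!. *)
Lemma kpoly0 (i k : nat) : (kpoly i k).[0] != 0.
Proof.
elim: k => [|k ih]; first by rewrite hornerC oner_eq0.
rewrite [X in X != 0](_ : _ = - ((k + i).+1%:R * (kpoly i k).[0])).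
  by rewrite oppr_eq0 mulf_neq0// pnatr_eq0.
by rewrite /= !hornerE /=; ring.
Qed.

Lemma derive1n_qker (t : imquat R) (k : nat) (x : R) : 0 < x ->
  derive1n k (fun x1 : R => qker (x1, t)) x =
  (kfun (imqsq t) 2 k x, - (kfun (imqsq t) 3 k x *: t)).
Proof.
elim: k x => [|k ih] x x0.
  have xn0 := lt0r_neq0 x0; have b0 := imqsq_ge0 t.
  have q0 : 0 < x ^+ 2 + imqsq t by rewrite ltr_pwDl// exprn_gt0.
  have K3 : (qnorm (x, t) ^+ 4)^-1 = kfun (imqsq t) 3 0 x.
    rewrite (exprM _ 2 2) qnorm_sqr /kfun /= hornerC.
    rewrite (_ : qsq (x, t) = x ^+ 2 + imqsq t); last first.
      by rewrite /qsq /imqsq /=; ring.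
    by field; rewrite xn0 lt0r_neq0.
  have K2 : kfun (imqsq t) 2 0 x = kfun (imqsq t) 3 0 x * x.
    rewrite /kfun /= [_^-1 ^+ 4]exprSr; field.
    by rewrite xn0 lt0r_neq0.
  rewrite K2 -K3 [LHS]/= /qker; congr pair; exact: scalerN.
rewrite [LHS](_ : _ = derive1 (derive1n k (fun x1 : R => qker (x1, t))) x)//.
rewrite derive1E.
pose F (y : R) : quat R := 
  (kfun (imqsq t) 2 k y, - (kfun (imqsq t) 3 k y *: t)).
(* The inductive formula holds only on x > 0, but a derivative depends only on values near the
   point, and positivity persists there. *)
rewrite (@near_eq_derive _ _ _ _ F); last first.
  near=> y; apply: ih; near: y; exact: lt_nbhsr.
have b0 := imqsq_ge0 t.
have D2 := is_derive_kfun 2 k b0 x0.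
have D3 := is_derive_kfun 3 k b0 x0.
have S (c : R) : is_derive x (1 : R) (fun y => - (kfun (imqsq t) 3 k y * c))
    (- (kfun (imqsq t) 3 k.+1 x * c)).
  have -> : (fun y => - (kfun (imqsq t) 3 k y * c)) =
      (- c) \*: (kfun (imqsq t) 3 k).
    apply/funext => y.
    by rewrite [RHS](_ : _ = - c * kfun (imqsq t) 3 k y)// mulNr mulrC.
  by apply: is_derive_eq; rewrite [_ *: _]mulrC mulrN.
have := is_derive_pair D2
  (is_derive_pair (is_derive_pair (S t.1.1) (S t.1.2)) (S t.2)).
by move=> [_ ->].
Unshelve. all: by end_near.
Qed.
End KernelDerivatives.

(** * Lower bound for the kernel on a cone *)

Section KernelLowerBound.
Context {R : realType}.

Lemma poly_near0_lower (p : {poly R}) : p.[0] != 0 ->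
  exists2 d : R, 0 < d & forall u, 0 <= u -> u <= d -> `|p.[0]| / 2 <= `|p.[u]|.
Proof.
move=> p0; have := @continuous_horner R p 0.
move/cvgr_dist_lt => /(_ (`|p.[0]| / 2)).
rewrite divr_gt0 ?normr_gt0// => /(_ isT)/nbhs_ballP[d /= d0 H].
(* Continuity gives an open ball of radius d; halving places the closed interval inside it. *)
exists (d / 2) => [|u u0 ud]; first by rewrite divr_gt0.
have : `|p.[0] - p.[u]| < `|p.[0]| / 2.
  by apply: H; rewrite /ball /= sub0r normrN ger0_norm//; lra.
have := ler_distD 0 p.[0] p.[u]; rewrite subr0 sub0r normrN.
have := lerB_dist p.[0] p.[u]; lra.
Qed.

Lemma abs_qre_le_qnorm (q : quat R) : `|q.1| <= qnorm q.
Proof.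
rewrite -(@ler_pXn2r _ 2)// ?nnegrE ?sqrtr_ge0// qnorm_sqr.
by rewrite real_normK ?num_real// /qsq -!addrA lerDl !addr_ge0// sqr_ge0.
Qed.

Lemma cs_kernel_lower_bound (c : R) (m : nat) : c != 0 ->
  exists d C : R, [/\ 0 < d, 0 < C & forall h : heis R m, 0 < vsq h.2 ->
    imqsq h.1 <= d * vsq h.2 ^+ 2 ->
    C / hnorm h ^+ (4 * m + 6) <= qnorm (cs_kernel c h)].
Proof.
move=> c0; have p0 := kpoly0 (R := R) 2 (2 * m).
have [d d0 dP] := poly_near0_lower p0.
set p := kpoly 2 (2 * m) in p0 dP.
(* Product of the worst values over 0 <= u <= d of the factors of the real part other than the power
   of |y|. *)
pose C := `|c| * (`|p.[0]| / 2) * (1 + d)^-1 ^+ (2 * m).+2.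
have d1 : 0 < 1 + d by rewrite addr_gt0.
have C0 : 0 < C.
  rewrite mulr_gt0 ?exprn_gt0 ?invr_gt0// mulr_gt0 ?normr_gt0//.
  by rewrite divr_gt0 ?normr_gt0.
exists d, C; split => // h x0 hd.
apply: le_trans (abs_qre_le_qnorm _).
rewrite /cs_kernel /cs_s /dre /qim /qre /= vnorm_sqr derive1n_qker//.
rewrite [X in `|X|](_ : _ = c * kfun (imqsq h.1) 2 (2 * m) (vsq h.2))//.
set x := vsq h.2 in x0 hd *; set b := imqsq h.1 in hd *.
have b0 : 0 <= b by exact: imqsq_ge0.
have u0 : 0 <= b * x^-1 ^+ 2 by rewrite mulr_ge0// sqr_ge0.
have ud : b * x^-1 ^+ 2 <= d by rewrite exprVn ler_pdivrMr ?exprn_gt0.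
rewrite /kfun -/p; set u := b * x^-1 ^+ 2 in u0 ud *.
have u1 : 0 < 1 + u by rewrite ltr_pwDl.
have X0 : 0 < x^-1 ^+ (2 * m + 2).+1 by rewrite exprn_gt0 ?invr_gt0.
have W0 : 0 < (1 + u)^-1 ^+ (2 * m).+2 by rewrite exprn_gt0 ?invr_gt0.
rewrite normrM [X in _ <= _ * X]normrM (gtr0_norm W0).
rewrite [X in _ <= _ * (X * _)]normrM (gtr0_norm X0).
have pu := dP u u0 ud.
have W1 : (1 + d)^-1 ^+ (2 * m).+2 <= (1 + u)^-1 ^+ (2 * m).+2.
  rewrite lerXn2r ?nnegrE ?invr_ge0 ?(ltW d1) ?(ltW u1)//.
  by rewrite lef_pV2 ?posrE// lerD2l.
have hn0 : 0 < hnorm h ^+ (4 * m + 6).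
  rewrite exprn_gt0//; apply: lt_le_trans (vnorm_le_hnorm h).
  by rewrite lt_neqAle vnorm_ge0 eq_sym -sqrf_eq0 vnorm_sqr (gt_eqF x0).
(* Since x = |y|^2, the right side is |y|^(-Q), and |y| <= ||h||. *)
have hn : (hnorm h ^+ (4 * m + 6))^-1 <= x^-1 ^+ (2 * m + 2).+1.
  have xE : x ^+ (2 * m + 2).+1 = vnorm h.2 ^+ (4 * m + 6).
    rewrite /x -vnorm_sqr -exprM; congr (_ ^+ _).
    by rewrite -addnS mulnDr mulnA.
  rewrite exprVn xE lef_pV2 ?posrE ?hn0//.
    rewrite lerXn2r ?nnegrE ?vnorm_ge0 ?hnorm_ge0//.
    exact: vnorm_le_hnorm.
  by rewrite -xE exprn_gt0.
apply: (@le_trans _ _ (C * x^-1 ^+ (2 * m + 2).+1)); first by rewrite ler_pM2l.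
have Wd0 : 0 <= (1 + d)^-1 ^+ (2 * m).+2.
  by rewrite exprn_ge0 ?invr_ge0 ?(ltW d1).
rewrite /C; move: W1 Wd0 X0.
move: (_ ^+ (2 * m).+2) (_ ^+ (2 * m).+2) (_ ^+ (2 * m + 2).+1).
move=> Wd Wu X W1 Wd0 X0.
rewrite -!mulrA ler_pM2l ?normr_gt0// [leRHS]mulrC !mulrA ler_pM2r//.
by apply: ler_pM => //; rewrite divr_ge0.
Qed.
End KernelLowerBound.

(** * Truncated cones *)

Section Sector.
Context {R : realType} {m : nat}.
Implicit Types (g h w u : heis R m).
Local Notation mu := (@heis_leb R m).
Local Notation Q := (4 * m + 6)%N.

Lemma hballE g (r : R) : 0 <= r ->
  hball g r = hmul (hinv g) @^-1` hnorm_ball r.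
Proof.
by move=> r0; apply/seteqP; split => h; rewrite /hball /hdist /= hnorm_lt.
Qed.

Definition base_sector (e r0 : R) : set (heis R m) :=
  hcone (e ^+ 2) `\` hnorm_ball r0.

Lemma measurable_base_sector (e r0 : R) : measurable (base_sector e r0).
Proof. exact: measurableD (measurable_hcone _) (measurable_hnorm_ball _). Qed.

Lemma measure_left_translate g (A : set (heis R m)) : measurable A ->
  mu (hmul g @^-1` A) = mu A.
Proof. by move=> mA; have [_ _ H] := scales_hmul g; rewrite H// mul1e. Qed.

Lemma hdistC g h : hdist g h = hdist h g.
Proof.
have H : hnorm (hmul (hinv h) g) ^+ 4 = hnorm (hmul (hinv g) h) ^+ 4.
  rewrite [LHS]hnorm_pow4 [RHS]hnorm_pow4 (hmul_inv_inv h g).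
  exact: hsq_hinv.
by apply: (pexpIrn (isT : (0 < 4)%N) _ _ H); rewrite nnegrE; exact: hnorm_ge0.
Qed.

Lemma vsq_hmulV g : vsq (hmul (hinv g) g).2 = 0.
Proof.
rewrite /vsq big1// => l _; rewrite !tnth_mktuple addNr /qsq /=; ring.
Qed.

(** The truncation bounds all distances below by r0, and this value is attained. Nonemptiness is
    recorded too, because [inf] takes a default value on the empty set. *)
Lemma inf_hdist_sector (e r0 : R) g : (0 < m)%N -> 0 <= r0 ->
  let S := hmul (hinv g) @^-1` base_sector e r0 in
  S !=set0 /\ inf [set hdist g g' | g' in S] = r0.
Proof.
move=> m0 r00 S.
(* The point with t = 0 and y = (r0, 0, ..., 0) lies in every cone and has norm exactly r0. *)
pose w : heis R m :=
  (0, [tuple if l == Ordinal m0 then (r0, 0) else 0 | l < m]).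
have vw : vsq w.2 = r0 ^+ 2.
  rewrite /vsq (bigD1 (Ordinal m0))//= big1.
    by rewrite tnth_mktuple eqxx /qsq /=; ring.
  by move=> l /negPf l0; rewrite tnth_mktuple l0 /qsq /=; ring.
have tw : imqsq w.1 = 0 by rewrite /imqsq /=; ring.
have Sw : S (hmul g w).
  rewrite /S /= hmulKV; split; rewrite /hcone /hnorm_ball /=.
    by rewrite tw mulr_ge0// sqr_ge0.
  by rewrite /hsq vw tw -exprM addr0 ltxx.
have lb : lbound [set hdist g g' | g' in S] r0.
  move=> _ [g' [_ Sg'] <-]; rewrite hdistC /hdist leNgt hnorm_lt//.
  exact/negP.
have in_ : [set hdist g g' | g' in S] r0.
  exists (hmul g w) => //; rewrite hdistC /hdist hmulKV.
  apply: (pexpIrn (isT : (0 < 4)%N)); rewrite ?nnegrE ?hnorm_ge0//.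
  by rewrite hnorm_pow4 /hsq vw tw -exprM addr0.
split; first by exists (hmul g w).
apply/le_anti/andP; split.
  by apply: ge_inf => //; exists r0.
by apply: lb_le_inf => //; exists r0.
Qed.

Lemma annulus_sector (e r0 r1 r2 : R) : 0 <= r0 -> r0 <= r1 -> r1 < r2 ->
  (hnorm_ball r2 `\` hnorm_ball r1) `&` base_sector e r0 =
  hcone (e ^+ 2) `&` (hnorm_ball r2 `\` hnorm_ball r1).
Proof.
move=> r00 r01 r12; have s := @hnorm_ball_subset R m _ _ r00 r01.
apply/seteqP; split => w; rewrite /base_sector /=.
  by move=> [[w2 w1] [wc _]].
by move=> [wc [w2 w1]]; split => //; split => // /s.
Qed.

(** The sector contains the part of the cone in the annulus from r0 to r, whose measure grows like
    r^Q. *)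
Lemma base_sector_infinite (e r0 : R) : (0 < m)%N -> 0 < e -> 0 < r0 ->
  mu (base_sector e r0) = +oo%E.
Proof.
move=> m0 e0 r00.
have e20 : 0 < e ^+ 2 by rewrite exprn_gt0.
have c0 := @hcone_ball_gt0 R m _ m0 e20.
have mC := @measurable_hcone R m (e ^+ 2).
have iC := @hcone_dilation_invariant R m (e ^+ 2).
have coo := homogeneous_ball_finite mC iC (@ltr01 R).
have cf : (mu (hcone (e ^+ 2) `&` hnorm_ball 1) \is a fin_num)%E.
  by rewrite ge0_fin_numE.
set E := mu (_ `&` _) in c0 coo cf.
have fE0 : 0 < fine E by rewrite fine_gt0// c0.
have H r : r0 < r ->
    (((r ^+ Q - r0 ^+ Q) * fine E)%:E <= mu (base_sector e r0))%E.
  move=> r0r; rewrite EFinM fineK// /E -measure_homogeneous_annulus//.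
  apply: le_measure; rewrite ?inE.
  - apply: measurableI mC _.
    exact: measurableD (measurable_hnorm_ball _) (measurable_hnorm_ball _).
  - exact: measurable_base_sector.
  - by move=> w [wc [_ w0]].
have [|] := ltP (mu (base_sector e r0)) +oo%E; last by rewrite leye_eq => /eqP.
rewrite -ge0_fin_numE// => Sf.
set M := fine (mu (base_sector e r0)).
have M0 : 0 <= M by exact: fine_ge0.
have q0 : 0 <= r0 ^+ Q by rewrite exprn_ge0// ltW.
have D0 : 0 <= (M + 1) / fine E by rewrite divr_ge0 ?(ltW fE0)// addr_ge0.
(* As r >= 1, r^Q >= r, so the annular part has measure at least M + 1, contradicting a finite total
   M. *)
pose r : R := r0 + 1 + r0 ^+ Q + (M + 1) / fine E.
have r0r : r0 < r by rewrite /r; lra.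
have r1 : 1 <= r by rewrite /r; lra.
have rQ : r <= r ^+ Q.
  by rewrite addnS exprS ler_peMr ?exprn_ege1// (le_trans ler01).
have := H r r0r; rewrite -[X in (_ <= X)%E]fineK// -/M lee_fin.
have : M + 1 <= (r ^+ Q - r0 ^+ Q) * fine E.
  by rewrite -ler_pdivrMr//; rewrite /r in rQ *; lra.
by move=> h1 h2; exfalso; lra.
Qed.

(** The cone and the whole group are both dilation-invariant, so in an annulus each has measure r2^Q
    - r1^Q times its measure in the unit ball. The ratio is an exact constant. *)
Lemma annulus_comparison (e r0 : R) : (0 < m)%N -> 0 < e -> 0 < r0 ->
  exists2 C1 : R, 0 < C1 & forall r1 r2 : R, r0 <= r1 -> r1 < r2 ->
    let A := hnorm_ball r2 `\` hnorm_ball r1 in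
    (C1%:E * mu A = mu (A `&` base_sector e r0))%E.
Proof.
move=> m0 e0 r00.
have e20 : 0 < e ^+ 2 by rewrite exprn_gt0.
have c0 := @hcone_ball_gt0 R m _ m0 e20.
have mC := @measurable_hcone R m (e ^+ 2).
have iC := @hcone_dilation_invariant R m (e ^+ 2).
have mT : measurable [set: heis R m] by [].
have iT : dilation_invariant [set: heis R m] by [].
have coo := homogeneous_ball_finite mC iC (@ltr01 R).
have boo := homogeneous_ball_finite mT iT (@ltr01 R).
have b0 : (0 < mu (setT `&` hnorm_ball 1))%E.
  apply: lt_le_trans c0 _; apply: le_measure; rewrite ?inE.
  - exact: measurableI mC (measurable_hnorm_ball _).
  - exact: measurableI mT (measurable_hnorm_ball _).
  - by move=> w [].
have annC r1 r2 := @measure_homogeneous_annulus R m _ r1 r2 mC iC.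
have annT r1 r2 := @measure_homogeneous_annulus R m _ r1 r2 mT iT.
move: c0 coo b0 boo annC annT.
set c := mu (_ `&` _); set b := mu (setT `&` _) => c0 coo b0 boo annC annT.
have cf : c = (fine c)%:E by rewrite fineK// ge0_fin_numE// ltW.
have bf : b = (fine b)%:E by rewrite fineK// ge0_fin_numE// ltW.
have fc : 0 < fine c by rewrite fine_gt0// c0.
have fb : 0 < fine b by rewrite fine_gt0// b0.
exists (fine c / fine b); first by rewrite divr_gt0.
move=> r1 r2 r01 r12 A.
have r10 : 0 < r1 by exact: lt_le_trans r01.
rewrite annulus_sector ?(ltW r00)// annC// -[A]setTI annT//.
rewrite cf bf -!EFinM; congr EFin; field; exact: lt0r_neq0.
Qed.

Lemma narrow_aperture (d : R) : 0 < d ->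
  exists e : R, [/\ 0 < e, e <= 1 & 432 * e ^+ 2 <= d].
Proof.
move=> d0; have d1 : 0 < d / 432 by lra.
exists (Num.min 1 (d / 432)); set e := Num.min _ _.
have e0 : 0 < e by rewrite lt_min ltr01 d1.
have e1 : e <= 1 by rewrite ge_min lexx.
have ed : e <= d / 432 by rewrite ge_min lexx orbT.
split=> //; move: e e0 e1 ed => e e0 e1 ed.
have : e ^+ 2 <= e by rewrite expr2 ler_piMr// ltW.
lra.
Qed.

Lemma large_radius (e : R) : 0 < e ->
  exists r0 : R, 4 <= r0 /\ 1 + e^-1 <= e * r0.
Proof.
(* Multiplying by e gives 4 e + 1 + e^-1. *)
move=> e0; exists (4 + e^-1 + e^-1 ^+ 2).
have i0 : 0 < e^-1 by rewrite invr_gt0.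
split; first by have := sqr_ge0 e^-1; lra.
by rewrite !mulrDr expr2 mulrA mulfV ?lt0r_neq0//; lra.
Qed.

(** On the narrow cone |t|^2 <= |y|^4, so ||w|| >= r0 forces 2 |y|^4 >= r0^4 >= 2 r0^2, hence |y|^2
    >= r0. The size conditions of [sector_stable] follow. *)
Lemma sector_ball_cone (d e r0 : R) w u : 0 < e -> e <= 1 -> 4 <= r0 ->
  1 + e^-1 <= e * r0 -> 432 * e ^+ 2 <= d ->
  base_sector e r0 w -> hnorm_ball 1 u ->
  let h := hmul (hinv w) u in
  0 < vsq h.2 /\ imqsq h.1 <= d * vsq h.2 ^+ 2.
Proof.
move=> e0 e1 r04 er0 ed [wc /negP wr] u1 h.
have u1' : hsq u <= 1 by move: u1; rewrite /hnorm_ball /= expr1n => /ltW.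
have v0 := vsq_ge0 w.2.
have x0 : r0 <= vsq w.2.
  have wr' : r0 ^+ 4 <= hsq w by rewrite leNgt.
  move: wc wr'; rewrite /hcone /hsq /= (exprM _ 2 2) => wc wr'.
  have e21 : e ^+ 2 * vsq w.2 ^+ 2 <= vsq w.2 ^+ 2.
    by rewrite ler_piMl ?sqr_ge0// exprn_ile1 ?(ltW e0).
  have r2 : 2 <= r0 ^+ 2 by rewrite expr2; nra.
  have r22 : 2 * r0 ^+ 2 <= (r0 ^+ 2) ^+ 2.
    by rewrite [leRHS]expr2 ler_pM2r//; lra.
  have : r0 ^+ 2 <= vsq w.2 ^+ 2 by lra.
  by rewrite ler_pXn2r// nnegrE; lra.
have ex : 1 + e^-1 <= e * vsq w.2 by rewrite (le_trans er0)// ler_pM2l.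
have [h0 hd] := sector_stable e0 (le_trans r04 x0) ex wc u1'.
split=> //; apply: (le_trans hd); rewrite ler_wpM2r//; exact: sqr_ge0.
Qed.

End Sector.

(** * Sectors at arbitrary base points *)

Theorem theorem1p4 (R : realType) (n : nat) (hn : (2 <= n)%N)
    (c : R) (hc : c != 0) :
  exists r0 C C1 C2 : R,
    [/\ 0 < r0, 0 < C, 0 < C1, 0 < C2 &
      forall g : heis R n.-1,
        exists S : set (heis R n.-1),
          [/\ measurable S,
              S !=set0 /\ inf [set hdist g g' | g' in S] = r0,
              forall g1 g2 : heis R n.-1, hball g 1 g1 -> S g2 ->
                g1 <> g2 /\
                C / hdist g1 g2 ^+ (4 * n + 2) <= qnorm (cs_kernel2 c g1 g2),
              heis_leb S = +oo%E &
              forall R1 R2 : R, 2 * r0 < R1 -> R1 < R2 ->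
                let A := hball g R2 `\` hball g R1 in
                (C1%:E * heis_leb A <= heis_leb (A `&` S) <=
                   C2%:E * heis_leb A)%E]].
Proof.
case: n hn => [//|m] /=; rewrite ltnS => m0.
(* Here m = n - 1, so Q = 4 n + 2 becomes 4 m + 6. *)
rewrite (_ : 4 * m.+1 + 2 = 4 * m + 6)%N; last first.
  by rewrite mulnS addnC addnA addnC.
have [d [C [d0 C0 HK]]] := cs_kernel_lower_bound m hc.
have [e [e0 e1 ed]] := narrow_aperture d0.
have [r0 [r04 er0]] := large_radius e0.
have r00 : 0 < r0 by lra.
have [C1 C10 HC1] := annulus_comparison m0 e0 r00.
(* The upper constant is 1, by inclusion of the intersection in the annulus. *)
exists r0, C, C1, 1; split; [exact: r00|exact: C0|exact: C10|exact: ltr01|].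
move=> g; pose L := hmul (hinv g).
have mL (A : set (heis R m)) : measurable A -> measurable (L @^-1` A).
  by have [_ + _] := scales_hmul (hinv g) => mh; exact: measurable_preimage mh.
exists (L @^-1` base_sector e r0); split.
- exact: mL (measurable_base_sector _ _).
- exact: inf_hdist_sector (ltW r00).
- move=> g1 g2; rewrite (hballE _ ler01) => u1 w0.
  have hw : hmul (hinv g2) g1 = hmul (hinv (L g2)) (L g1).
    exact: hmul_hinv_mul.
  have [h0 hd] := sector_ball_cone e0 e1 r04 er0 ed w0 u1.
  rewrite -hw in h0 hd.
  split; last exact: HK h0 hd.
  (* The horizontal part of g2^-1 g1 is nonzero, so the kernel is not evaluated at the neutral
     element. *)
  by move=> g12; move: h0; rewrite g12 vsq_hmulV ltxx.
- rewrite measure_left_translate; last exact: measurable_base_sector.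
  exact: base_sector_infinite.
- move=> R1 R2 r01 r12.
  have [R10 r0R1] : 0 < R1 /\ r0 <= R1 by split; lra.
  have AE : hball g R2 `\` hball g R1 =
      L @^-1` (hnorm_ball R2 `\` hnorm_ball R1).
    by rewrite !hballE ?(ltW R10)// ltW// (lt_trans R10).
  have mA : measurable (hnorm_ball R2 `\` (hnorm_ball R1 : set (heis R m))).
    exact: measurableD (measurable_hnorm_ball _) (measurable_hnorm_ball _).
  rewrite AE -preimage_setI !measure_left_translate//; last first.
    exact: measurableI mA (measurable_base_sector _ _).
  rewrite HC1// lexx /= mul1e; apply: le_measure; rewrite ?inE//.
  exact: measurableI mA (measurable_base_sector _ _).
Qed.
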